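(* Let $H = (H,\mu_H,\Delta_H)$ be a bialgebra, let $C = (C,\Delta_C)$ be an $H$-comodule coalgebra via $\delta \colon C \to H \otimes C$, and let $\alpha_C \colon C \to C$ be a coalgebra endomorphism that is also $H$-colinear, i.e. $\delta\circ\alpha_C=(\mathrm{id}_H\otimes\alpha_C)\circ\delta$. Then the map $\delta_\alpha=\delta\circ\alpha_C\colon C\to H\otimes C$ gives the Hom-coassociative coalgebra $C_\alpha=(C,\ \Delta_{\alpha,C}=\Delta_C\circ\alpha_C,\ \alpha_C)$ the structure of an $H$-comodule Hom-coalgebra, where $H$ denotes the Hom-bialgebra $(H,\mu_H,\Delta_H,\mathrm{id}_H)$.
   Context: Vector spaces and linear maps are over a field $\mathbb{F}$ of any characteristic. For vector spaces $U,V$, $\tau_{U,V}\colon U\otimes V\to V\otimes U$ is the twist map $u\otimes v\mapsto v\otimes u$. A bialgebra $(H,\mu_H,\Delta_H)$ consists of an associative multiplication $\mu_H\colon H\otimes H\to H$ and a coassociative comultiplication $\Delta_H\colon H\to H\otimes H$ with $\Delta_H\circ\mu_H=\mu_H^{\otimes 2}\circ(\mathrm{id}_H\otimes\tau_{H,H}\otimes\mathrm{id}_H)\circ\Delta_H^{\otimes 2}$; units and counits are not part of the data. A coalgebra $(C,\Delta_C)$ is a vector space with a coassociative comultiplication; a coalgebra endomorphism is a linear map $\alpha_C$ with $\Delta_C\circ\alpha_C=\alpha_C^{\otimes 2}\circ\Delta_C$. For a bialgebra $H$, a coalgebra $(C,\Delta_C)$ is an $H$-comodule coalgebra via a linear map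 $\delta\colon C\to H\otimes C$ if $(\mathrm{id}_H\otimes\delta)\circ\delta=(\Delta_H\otimes\mathrm{id}_C)\circ\delta$ and $(\mathrm{id}_H\otimes\Delta_C)\circ\delta=\delta_{CC}\circ\Delta_C$, where $\delta_{CC}(c\otimes d)=\sum c_{(-1)}d_{(-1)}\otimes c_{(0)}\otimes d_{(0)}$ with $\delta(c)=\sum c_{(-1)}\otimes c_{(0)}$ and the product taken with $\mu_H$. A Hom-module is a pair $(V,\alpha)$ with $V$ a vector space and $\alpha\colon V\to V$ linear. A Hom-associative algebra is a triple $(A,\mu,\alpha)$ with $(A,\alpha)$ a Hom-module and $\mu\colon A\otimes A\to A$ linear such that $\alpha\circ\mu=\mu\circ\alpha^{\otimes 2}$ and $\mu\circ(\alpha\otimes\mu)=\mu\circ(\mu\otimes\alpha)$. A Hom-coassociative coalgebra is a triple $(C,\Delta,\alpha)$ with $(C,\alpha)$ a Hom-module and $\Delta\colon C\to C\otimes C$ linear such that $\Delta\circ\alpha=\alpha^{\otimes 2}\circ\Delta$ and $(\alpha\otimes\Delta)\circ\Delta=(\Delta\otimes\alpha)\circ\Delta$. A Hom-bialgebra is a quadruple $(H,\mu,\Delta,\alpha)$ such that $(H,\mu,\alpha)$ is a Hom-associative algebra, $(H,\Delta,\alpha)$ is a Hom-coassociative coalgebra, and $\Delta\circ\mu=\mu^{\otimes 2}\circ(\mathrm{id}_H\otimes\tau_{H,H}\otimes\mathrm{id}_H)\circ\Delta^{\otimes 2}$. For a Hom-bialgebra $(H,\mu,\Delta,\alpha_H)$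 and a Hom-module $(M,\alpha_M)$, an $H$-comodule structure on $M$ is a linear map $\rho\colon M\to H\otimes M$ with $\rho\circ\alpha_M=(\alpha_H\otimes\alpha_M)\circ\rho$ and $(\alpha_H\otimes\rho)\circ\rho=(\Delta\otimes\alpha_M)\circ\rho$. For a Hom-bialgebra $(H,\mu,\Delta,\alpha_H)$ and a Hom-coassociative coalgebra $(D,\Delta_D,\alpha_D)$, an $H$-comodule Hom-coalgebra structure on $D$ is an $H$-comodule structure $\rho\colon D\to H\otimes D$ on $(D,\alpha_D)$ such that $(\alpha_H^2\otimes\Delta_D)\circ\rho=\rho_{DD}\circ\Delta_D$, where $\rho_{DD}\colon D\otimes D\to H\otimes D\otimes D$ is given by $\rho_{DD}(c\otimes d)=\sum \mu(c_{(-1)}\otimes d_{(-1)})\otimes c_{(0)}\otimes d_{(0)}$ with $\rho(c)=\sum c_{(-1)}\otimes c_{(0)}$. *)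

(* Defs.v *)
From HB Require Import structures.
From mathcomp Require Import all_boot all_order all_algebra.
From mathcomp Require Import boolp.

Set Implicit Arguments.
Unset Strict Implicit.
Unset Printing Implicit Defensive.

Import GRing.Theory.
Local Open Scope ring_scope.
Local Open Scope quotient_scope.

(* The tensor product of two vector spaces of arbitrary dimension. A formal
   sum u_1 (x) v_1 + ... + u_n (x) v_n is a sequence of pairs, and the tensor
   product is the quotient of the monoid of formal sums by the congruence
   generated by commutativity and bilinearity. No formal coefficients are
   needed, as a scalar can be absorbed in the left component. The universal
   property is given by tlift, tliftE, tlift_linear and tensor_ext. *)
Section Tensor.
Variables (F : fieldType) (U V : lmodType F).
Implicit Types (s t : seq (U * V)).

Inductive tensor_eq : seq (U * V) -> seq (U * V) -> Prop :=
| teq_refl s : tensor_eq s s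
| teq_sym s t : tensor_eq s t -> tensor_eq t s
| teq_trans s t r : tensor_eq s t -> tensor_eq t r -> tensor_eq s r
| teq_cat s s' t t' :
    tensor_eq s s' -> tensor_eq t t' -> tensor_eq (s ++ t) (s' ++ t')
| teq_catC s t : tensor_eq (s ++ t) (t ++ s)
| teq_addl u u' v : tensor_eq [:: (u + u', v)] [:: (u, v); (u', v)]
| teq_addr u v v' : tensor_eq [:: (u, v + v')] [:: (u, v); (u, v')]
| teq_scale a u v : tensor_eq [:: (a *: u, v)] [:: (u, a *: v)]
| teq_zero v : tensor_eq [:: (0, v)] [::].

Definition tensor_rel s t : bool := `[< tensor_eq s t >].

Lemma tensor_rel_refl : reflexive tensor_rel.
Proof. by move=> s; apply/asboolP; exact: teq_refl. Qed.

Lemma tensor_rel_sym : symmetric tensor_rel.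
Proof. by move=> s t; apply/asboolP/asboolP; exact: teq_sym. Qed.

Lemma tensor_rel_trans : transitive tensor_rel.
Proof.
move=> t s r /asboolP st /asboolP tr; apply/asboolP; exact: teq_trans st tr.
Qed.

Canonical tensor_equiv :=
  EquivRel tensor_rel tensor_rel_refl tensor_rel_sym tensor_rel_trans.

Definition tensor : Type := {eq_quot tensor_rel}.

HB.instance Definition _ := Choice.on tensor.
HB.instance Definition _ := EqQuotient.on tensor.

Lemma tensor_piP s t : tensor_eq s t <-> \pi_tensor s = \pi_tensor t.
Proof. by split=> [st|/eqmodP/asboolP //]; apply/eqmodP/asboolP. Qed.

Lemma teq_repr s : tensor_eq (repr (\pi_tensor s)) s.
Proof. by apply/tensor_piP; rewrite reprK. Qed.

Lemma tensor_piW (P : tensor -> Prop) :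
  (forall s, P (\pi_tensor s)) -> forall x, P x.
Proof. by move=> Ppi x; rewrite -[x]reprK. Qed.

Definition fscale (a : F) s := [seq (a *: p.1, p.2) | p <- s].

Lemma fscale_eq a s t : tensor_eq s t -> tensor_eq (fscale a s) (fscale a t).
Proof.
rewrite /fscale; elim=> {s t} //=.
- by move=> s; exact: teq_refl.
- by move=> s t _; exact: teq_sym.
- by move=> s t r _ st _; exact: teq_trans.
- by move=> s s' t t' _ st _ st'; rewrite !map_cat; exact: teq_cat.
- by move=> s t; rewrite !map_cat; exact: teq_catC.
- by move=> u u' v; rewrite scalerDr; exact: teq_addl.
- by move=> u v v'; exact: teq_addr.
- by move=> b u v; rewrite scalerA mulrC -scalerA; exact: teq_scale.
- by move=> v; rewrite scaler0; exact: teq_zero.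
Qed.

Definition tensor_zero : tensor := \pi_tensor [::].
Definition tensor_add (x y : tensor) : tensor := \pi_tensor (repr x ++ repr y).
Definition tensor_scale (a : F) (x : tensor) : tensor := \pi_tensor (fscale a (repr x)).
Definition tensor_opp (x : tensor) : tensor := tensor_scale (-1) x.

Lemma tensor_add_pi s t : tensor_add (\pi_tensor s) (\pi_tensor t) = \pi_tensor (s ++ t).
Proof. by apply/tensor_piP/teq_cat; exact: teq_repr. Qed.

Lemma tensor_scale_pi a s : tensor_scale a (\pi_tensor s) = \pi_tensor (fscale a s).
Proof. by apply/tensor_piP/fscale_eq; exact: teq_repr. Qed.

Lemma tensor_addA : associative tensor_add.
Proof.
move=> x y z; elim/tensor_piW: x => s; elim/tensor_piW: y => t.
elim/tensor_piW: z => r.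
by rewrite !tensor_add_pi catA.
Qed.

Lemma tensor_addC : commutative tensor_add.
Proof.
move=> x y; elim/tensor_piW: x => s; elim/tensor_piW: y => t; rewrite !tensor_add_pi.
by apply/tensor_piP; exact: teq_catC.
Qed.

Lemma tensor_add0 : left_id tensor_zero tensor_add.
Proof. by move=> x; elim/tensor_piW: x => s; rewrite tensor_add_pi. Qed.

Lemma fscaleDl a b s : tensor_eq (fscale (a + b) s) (fscale a s ++ fscale b s).
Proof.
elim: s => [|[u v] s IHs] /=; first exact: teq_refl.
rewrite scalerDl -cat1s.
apply: teq_trans (teq_cat (teq_addl _ _ _) IHs) _.
rewrite -[_ ++ _]/([:: (a *: u, v)] ++ ([:: (b *: u, v)] ++ (_ ++ _))).
rewrite -[X in tensor_eq _ X]/([:: (a *: u, v)] ++ (_ ++ ([:: (b *: u, v)] ++ _))).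
apply: teq_cat (teq_refl _) _; rewrite !catA.
by apply: teq_cat (teq_catC _ _) (teq_refl _).
Qed.

Lemma fscale0 s : tensor_eq (fscale 0 s) [::].
Proof.
elim: s => [|[u v] s IHs] /=; first exact: teq_refl.
by rewrite scale0r -cat1s; apply: (teq_cat (teq_zero v) IHs).
Qed.

Lemma tensor_addN : left_inverse tensor_zero tensor_opp tensor_add.
Proof.
move=> x; elim/tensor_piW: x => s; rewrite /tensor_opp tensor_scale_pi tensor_add_pi.
apply/tensor_piP.
have -> : s = fscale 1 s.
  by rewrite /fscale -[LHS]map_id; apply: eq_map => -[u v] /=; rewrite scale1r.
have -> : fscale (-1) (fscale 1 s) = fscale (-1) s.
  by rewrite /fscale -map_comp; apply: eq_map => -[u v] /=; rewrite scale1r.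
apply: teq_trans (teq_sym (fscaleDl _ _ _)) _.
by rewrite addNr; exact: fscale0.
Qed.

HB.instance Definition _ := GRing.isZmodule.Build tensor
  tensor_addA tensor_addC tensor_add0 tensor_addN.

Lemma tensor_scaleA a b x :
  tensor_scale a (tensor_scale b x) = tensor_scale (a * b) x.
Proof.
elim/tensor_piW: x => s; rewrite !tensor_scale_pi; congr (\pi_tensor _).
by rewrite /fscale -map_comp; apply: eq_map => p /=; rewrite scalerA.
Qed.

Lemma tensor_scale1 : left_id 1 tensor_scale.
Proof.
move=> x; elim/tensor_piW: x => s; rewrite tensor_scale_pi; congr (\pi_tensor _).
by rewrite /fscale -[RHS]map_id; apply: eq_map => -[u v] /=; rewrite scale1r.
Qed.

Lemma tensor_scaleDr : right_distributive tensor_scale +%R.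
Proof.
move=> a x y; elim/tensor_piW: x => s; elim/tensor_piW: y => t.
by rewrite /+%R /= !(tensor_add_pi, tensor_scale_pi) /fscale map_cat.
Qed.

Lemma tensor_scaleDl x : {morph tensor_scale^~ x : a b / a + b}.
Proof.
move=> a b; elim/tensor_piW: x => s.
rewrite [in RHS]/+%R /= !(tensor_add_pi, tensor_scale_pi).
by apply/tensor_piP; exact: fscaleDl.
Qed.

HB.instance Definition _ := GRing.Zmodule_isLmodule.Build F tensor
  tensor_scaleA tensor_scale1 tensor_scaleDr tensor_scaleDl.

Definition pure (u : U) (v : V) : tensor := \pi_tensor [:: (u, v)].

Lemma pi_tensorE s : \pi_tensor s = \sum_(p <- s) pure p.1 p.2.
Proof.
elim: s => [|[u v] s IHs]; first by rewrite big_nil.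
by rewrite big_cons -IHs /= [RHS]tensor_add_pi.
Qed.

Lemma pureDl v : {morph pure^~ v : u u' / u + u'}.
Proof.
move=> u u'; rewrite [RHS]tensor_add_pi.
by apply/tensor_piP; exact: teq_addl.
Qed.

Lemma pureDr u : {morph pure u : v v' / v + v'}.
Proof.
move=> v v'; rewrite [RHS]tensor_add_pi.
by apply/tensor_piP; exact: teq_addr.
Qed.

Lemma pureZl a u v : pure (a *: u) v = a *: pure u v.
Proof. by rewrite [RHS]tensor_scale_pi. Qed.

Lemma pureZr a u v : pure u (a *: v) = a *: pure u v.
Proof.
by rewrite -pureZl; apply/tensor_piP/teq_sym; exact: teq_scale.
Qed.

Lemma pure_bilinear : bilinear_for *:%R *:%R pure.
Proof.
by split=> [v a u u'|u a v v'] /=; rewrite ?pureDl ?pureDr ?pureZl ?pureZr.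
Qed.

Lemma tensor_ind (P : tensor -> Prop) :
  P 0 -> (forall u v x, P x -> P (pure u v + x)) -> forall x, P x.
Proof.
move=> P0 PD; move=> x; elim/tensor_piW: x => s; rewrite pi_tensorE.
by elim: s => [|p s IHs]; rewrite ?big_nil // big_cons; exact: PD.
Qed.

Lemma tensor_ext (W : lmodType F) (f g : {linear tensor -> W}) :
  (forall u v, f (pure u v) = g (pure u v)) -> f =1 g.
Proof.
move=> fg; elim/tensor_ind=> [|u v x fgx]; first by rewrite !linear0.
by rewrite !linearD fg fgx.
Qed.

(* Meaningful only for bilinear f; see tliftE. *)
Definition tlift (W : lmodType F) (f : U -> V -> W) (x : tensor) : W :=
  \sum_(p <- repr x) f p.1 p.2.

Section Lift.
Variables (W : lmodType F) (f : U -> V -> W).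
Hypothesis f_bilin : bilinear_for *:%R *:%R f.

Let fDl u u' v : f (u + u') v = f u v + f u' v.
Proof. by have /= := f_bilin.1 v 1 u u'; rewrite !scale1r. Qed.

Let fDr u v v' : f u (v + v') = f u v + f u v'.
Proof. by have /= := f_bilin.2 u 1 v v'; rewrite !scale1r. Qed.

Let f0l v : f 0 v = 0.
Proof. by apply: (@addrI _ (f 0 v)); rewrite -fDl !addr0. Qed.

Let f0r u : f u 0 = 0.
Proof. by apply: (@addrI _ (f u 0)); rewrite -fDr !addr0. Qed.

Let fZl a u v : f (a *: u) v = a *: f u v.
Proof. by have /= := f_bilin.1 v a u 0; rewrite f0l !addr0. Qed.

Let fZr a u v : f u (a *: v) = a *: f u v.
Proof. by have /= := f_bilin.2 u a v 0; rewrite f0r !addr0. Qed.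

Let sum_eq s t : tensor_eq s t ->
  \sum_(p <- s) f p.1 p.2 = \sum_(p <- t) f p.1 p.2.
Proof.
elim=> {s t}.
- by [].
- by move=> s t _ ->.
- by move=> s t r _ -> _ ->.
- by move=> s s' t t' _ st _ st'; rewrite !big_cat /= st st'.
- by move=> s t; rewrite !big_cat /= addrC.
- by move=> u u' v; rewrite !big_cons !big_nil /= fDl !addr0.
- by move=> u v v'; rewrite !big_cons !big_nil /= fDr !addr0.
- by move=> a u v; rewrite !big_cons !big_nil /= fZl fZr.
- by move=> v; rewrite !big_cons !big_nil /= f0l addr0.
Qed.

Lemma tlift_pi s : tlift f (\pi_tensor s) = \sum_(p <- s) f p.1 p.2.
Proof. exact: sum_eq (teq_repr s). Qed.

Lemma tliftE u v : tlift f (pure u v) = f u v.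
Proof. by rewrite tlift_pi big_seq1. Qed.

Lemma tlift_linear : linear (tlift f).
Proof.
move=> a x y; elim/tensor_piW: x => s; elim/tensor_piW: y => t.
have -> : a *: \pi_tensor s + \pi_tensor t = \pi_tensor (fscale a s ++ t).
  by rewrite -[_ *: _]/(tensor_scale _ _) tensor_scale_pi -tensor_add_pi.
rewrite !tlift_pi big_cat big_map /= scaler_sumr; congr (_ + _).
by apply: eq_bigr => p _; rewrite fZl.
Qed.

End Lift.

End Tensor.

Notation "U \ox V" := (tensor U%type V%type)
  (at level 40, left associativity) : type_scope.
Notation "u \ox v" := (pure u v)
  (at level 40, left associativity) : ring_scope.

Section TensorMaps.
Variable F : fieldType.

Section Tmap.
Variables (U V U' V' : lmodType F).

Definition tmap (f : U -> U') (g : V -> V') : U \ox V -> U' \ox V' :=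
  tlift (fun u v => f u \ox g v).

Variables (f : {linear U -> U'}) (g : {linear V -> V'}).

Lemma tmap_bilinear : bilinear_for *:%R *:%R (fun u v => f u \ox g v).
Proof.
split=> [v a u u'|u a v v'] /=; rewrite linearP.
  by rewrite pureDl pureZl.
by rewrite pureDr pureZr.
Qed.

HB.instance Definition _ := GRing.isLinear.Build F (U \ox V)%type (U' \ox V')%type
  *:%R (tmap f g) (tlift_linear tmap_bilinear).

Lemma tmapE u v : tmap f g (u \ox v) = f u \ox g v.
Proof. exact: (tliftE tmap_bilinear). Qed.

End Tmap.

Section Twist.
Variables U V : lmodType F.

Definition twist : U \ox V -> V \ox U :=
  tlift (fun u v => v \ox u).

Lemma twist_bilinear :
  bilinear_for *:%R *:%R (fun (u : U) (v : V) => v \ox u).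
Proof.
by split=> [v a u u'|u a v v'] /=; rewrite ?pureDl ?pureDr ?pureZl ?pureZr.
Qed.

HB.instance Definition _ := GRing.isLinear.Build F (U \ox V)%type (V \ox U)%type
  *:%R twist (tlift_linear twist_bilinear).

Lemma twistE u v : twist (u \ox v) = v \ox u.
Proof. exact: (tliftE twist_bilinear). Qed.

End Twist.

Section Assoc.
Variables U V W : lmodType F.

Definition tassoc : U \ox V \ox W -> U \ox (V \ox W) :=
  tlift (fun x w => tlift (fun u v => u \ox (v \ox w)) x).

Definition tassocI : U \ox (V \ox W) -> U \ox V \ox W :=
  tlift (fun u y => tlift (fun v w => u \ox v \ox w) y).

Lemma tassoc_bilinear1 (w : W) :
  bilinear_for *:%R *:%R (fun (u : U) (v : V) => u \ox (v \ox w)).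
Proof.
by split=> [v a u u'|u a v v'] /=;
  rewrite ?(pureDl, pureZl) ?pureDr ?pureZr.
Qed.

Lemma tassoc_bilinear : bilinear_for *:%R *:%R
  (fun (x : U \ox V) (w : W) => tlift (fun u v => u \ox (v \ox w)) x).
Proof.
split=> [w|x a w w'] /=; first exact: tlift_linear (tassoc_bilinear1 w).
rewrite /tlift scaler_sumr -big_split; apply: eq_bigr => p _ /=.
by rewrite !(pureDr, pureZr).
Qed.

HB.instance Definition _ := GRing.isLinear.Build F
  (U \ox V \ox W)%type (U \ox (V \ox W))%type
  *:%R tassoc (tlift_linear tassoc_bilinear).

Lemma tassocE u v w : tassoc (u \ox v \ox w) = u \ox (v \ox w).
Proof.
by rewrite /tassoc (tliftE tassoc_bilinear) (tliftE (tassoc_bilinear1 w)).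
Qed.

Lemma tassocI_bilinear1 (u : U) :
  bilinear_for *:%R *:%R (fun (v : V) (w : W) => u \ox v \ox w).
Proof.
by split=> [w a v v'|v a w w'] /=; rewrite !(pureDl, pureZl, pureDr, pureZr).
Qed.

Lemma tassocI_bilinear : bilinear_for *:%R *:%R
  (fun (u : U) (y : V \ox W) => tlift (fun v w => u \ox v \ox w) y).
Proof.
split=> [y a u u'|u] /=; last exact: tlift_linear (tassocI_bilinear1 u).
rewrite /tlift scaler_sumr -big_split; apply: eq_bigr => p _ /=.
by rewrite !(pureDl, pureZl).
Qed.

HB.instance Definition _ := GRing.isLinear.Build F
  (U \ox (V \ox W))%type (U \ox V \ox W)%type
  *:%R tassocI (tlift_linear tassocI_bilinear).

Lemma tassocIE u v w : tassocI (u \ox (v \ox w)) = u \ox v \ox w.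
Proof.
by rewrite /tassocI (tliftE tassocI_bilinear) (tliftE (tassocI_bilinear1 u)).
Qed.

End Assoc.

Arguments twist : clear implicits.
Arguments tassoc : clear implicits.
Arguments tassocI : clear implicits.

Section MiddleTwist.
Variables U V W X : lmodType F.

(* id (x) tau (x) id, made explicit on parenthesized tensor products *)
Definition mid_twist :
    (U \ox V) \ox (W \ox X) -> (U \ox W) \ox (V \ox X) :=
  tassocI U W (V \ox X)%type
  \o tmap idfun (tassoc W V X \o tmap (twist V W) idfun \o tassocI V W X)
  \o tassoc U V (W \ox X)%type.

HB.instance Definition _ := GRing.Linear.on mid_twist.

Lemma mid_twistE u v w x :
  mid_twist ((u \ox v) \ox (w \ox x)) = (u \ox w) \ox (v \ox x).
Proof.
by rewrite /mid_twist /= tassocE tmapE /= tassocIE tmapE /= twistE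
  tassocE tassocIE.
Qed.

End MiddleTwist.

End TensorMaps.

Arguments twist {F} U V _.
Arguments tassoc {F} U V W _.
Arguments tassocI {F} U V W _.
Arguments mid_twist {F} U V W X _.

(* The identification of (U (x) V) (x) W with U (x) (V (x) W) is made explicit
   by tassoc. No structure has a unit or a counit. *)
Section Structures.
Variable F : fieldType.

Record is_bialgebra (H : lmodType F)
    (mu : {linear (H \ox H)%type -> H}) (Delta : {linear H -> (H \ox H)%type})
    : Prop := IsBialgebra {
  bialg_mulA : mu \o tmap idfun mu \o tassoc H H H =1 mu \o tmap mu idfun ;
  bialg_comulA :
    tmap idfun Delta \o Delta =1 tassoc H H H \o tmap Delta idfun \o Delta ;
  bialg_compat :
    Delta \o mu =1 tmap mu mu \o mid_twist H H H H \o tmap Delta Delta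
}.

Definition is_coalgebra (C : lmodType F) (Delta : {linear C -> (C \ox C)%type})
    : Prop :=
  tmap idfun Delta \o Delta =1 tassoc C C C \o tmap Delta idfun \o Delta.

Definition is_coalgebra_endo (C : lmodType F)
    (Delta : {linear C -> (C \ox C)%type}) (alpha : {linear C -> C}) : Prop :=
  Delta \o alpha =1 tmap alpha alpha \o Delta.

(* c (x) d |-> sum c_(-1) d_(-1) (x) (c_(0) (x) d_(0)) *)
Definition codiagonal (H C : lmodType F) (mu : {linear (H \ox H)%type -> H})
    (rho : {linear C -> (H \ox C)%type}) :
    C \ox C -> H \ox (C \ox C) :=
  tmap mu idfun \o mid_twist H C H C \o tmap rho rho.

HB.instance Definition _ (H C : lmodType F)
    (mu : {linear (H \ox H)%type -> H}) (rho : {linear C -> (H \ox C)%type}) :=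
  GRing.Linear.on (codiagonal mu rho).

Record is_comodule_coalgebra (H : lmodType F)
    (mu : {linear (H \ox H)%type -> H}) (DeltaH : {linear H -> (H \ox H)%type})
    (C : lmodType F) (DeltaC : {linear C -> (C \ox C)%type})
    (delta : {linear C -> (H \ox C)%type}) : Prop := IsComoduleCoalgebra {
  comod_coalg_coact :
    tmap idfun delta \o delta
    =1 tassoc H H C \o tmap DeltaH idfun \o delta ;
  comod_coalg_comul :
    tmap idfun DeltaC \o delta =1 codiagonal mu delta \o DeltaC
}.

Record is_hom_algebra (A : lmodType F)
    (mu : {linear (A \ox A)%type -> A}) (alpha : {linear A -> A})
    : Prop := IsHomAlgebra {
  hom_alg_mult : alpha \o mu =1 mu \o tmap alpha alpha ;
  hom_alg_assoc :
    mu \o tmap alpha mu \o tassoc A A A =1 mu \o tmap mu alpha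
}.

Record is_hom_coalgebra (C : lmodType F)
    (Delta : {linear C -> (C \ox C)%type}) (alpha : {linear C -> C})
    : Prop := IsHomCoalgebra {
  hom_coalg_comult : Delta \o alpha =1 tmap alpha alpha \o Delta ;
  hom_coalg_coassoc :
    tmap alpha Delta \o Delta =1 tassoc C C C \o tmap Delta alpha \o Delta
}.

Record is_hom_bialgebra (H : lmodType F)
    (mu : {linear (H \ox H)%type -> H}) (Delta : {linear H -> (H \ox H)%type})
    (alpha : {linear H -> H}) : Prop := IsHomBialgebra {
  hom_bialg_alg : is_hom_algebra mu alpha ;
  hom_bialg_coalg : is_hom_coalgebra Delta alpha ;
  hom_bialg_compat :
    Delta \o mu =1 tmap mu mu \o mid_twist H H H H \o tmap Delta Delta
}.

Record is_hom_comodule (H : lmodType F)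
    (Delta : {linear H -> (H \ox H)%type}) (alphaH : {linear H -> H})
    (M : lmodType F) (alphaM : {linear M -> M})
    (rho : {linear M -> (H \ox M)%type}) : Prop := IsHomComodule {
  hom_comod_comult : rho \o alphaM =1 tmap alphaH alphaM \o rho ;
  hom_comod_coassoc :
    tmap alphaH rho \o rho =1 tassoc H H M \o tmap Delta alphaM \o rho
}.

Record is_comodule_hom_coalgebra (H : lmodType F)
    (mu : {linear (H \ox H)%type -> H}) (DeltaH : {linear H -> (H \ox H)%type})
    (alphaH : {linear H -> H})
    (D : lmodType F) (DeltaD : {linear D -> (D \ox D)%type})
    (alphaD : {linear D -> D}) (rho : {linear D -> (H \ox D)%type})
    : Prop := IsComoduleHomCoalgebra {
  comod_hom_coalg_bialg : is_hom_bialgebra mu DeltaH alphaH ;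
  comod_hom_coalg_coalg : is_hom_coalgebra DeltaD alphaD ;
  comod_hom_coalg_comod : is_hom_comodule DeltaH alphaH alphaD rho ;
  comod_hom_coalg_comul :
    tmap (alphaH \o alphaH) DeltaD \o rho =1 codiagonal mu rho \o DeltaD
}.

End Structures.

(* Main.v *)
Require Import Defs.
From HB Require Import structures.
From mathcomp Require Import all_boot all_order all_algebra.

Set Implicit Arguments.
Unset Strict Implicit.
Unset Printing Implicit Defensive.

Import GRing.Theory.
Local Open Scope ring_scope.

(* Naturality pushes the endomorphism alpha through every structure map, so
   each twisted axiom at x is the untwisted axiom at an iterate of alpha on x,
   followed by a tensor product of copies of alpha and identities. *)

Section TensorFunctoriality.
Variable F : fieldType.

(** Both sides are sums over the same chosen representative of the tensor, so they agree term by
    term, for arbitrary functions. *)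
Lemma eq_tmap (U V U' V' : lmodType F) (f f' : U -> U') (g g' : V -> V') :
  f =1 f' -> g =1 g' -> tmap f g =1 tmap f' g'.
Proof.
by move=> eqf eqg x; apply: eq_bigr => p _; rewrite eqf eqg.
Qed.

Lemma tmap_id (U V : lmodType F) : @tmap F U V U V idfun idfun =1 idfun.
Proof. by apply: tensor_ext => u v /=; rewrite tmapE. Qed.

(** Taking [h] and [k] up to pointwise equality lets colinearity or the endomorphism property serve
    directly as a factorization, and lets [alpha] be split off an identity on either side. *)
Lemma tmap_comp (U V U' V' U'' V'' : lmodType F)
    (f' : {linear U' -> U''}) (g' : {linear V' -> V''})
    (f : {linear U -> U'}) (g : {linear V -> V'}) (h : U -> U'') (k : V -> V'') :
  h =1 f' \o f -> k =1 g' \o g -> tmap h k =1 tmap f' g' \o tmap f g.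
Proof.
move=> eqh eqk x; rewrite (eq_tmap eqh eqk); move: x.
by apply: tensor_ext => u v; rewrite /= !tmapE.
Qed.

Lemma tassoc_natural (U V W U' V' W' : lmodType F) (f : {linear U -> U'})
    (g : {linear V -> V'}) (h : {linear W -> W'}) x :
  tassoc U' V' W' (tmap (tmap f g) h x) = tmap f (tmap g h) (tassoc U V W x).
Proof.
rewrite -[LHS]/((tassoc U' V' W' \o tmap (tmap f g) h) x).
rewrite -[RHS]/((tmap f (tmap g h) \o tassoc U V W) x); move: x.
apply: tensor_ext => y w /=; rewrite tmapE.
(* [tensor_ext] decomposes only the outer tensor; the left factor [y] is still a general element of
   [U \ox V]. *)
elim/tensor_ind: y => [|u v y IHy].
  have pure0l (X Y : lmodType F) (z : Y) : 0 \ox z = 0 :> (X \ox Y)%type.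
    by rewrite -(scale0r 0) pureZl scale0r.
  by rewrite !(linear0, pure0l).
by rewrite linearD !pureDl !linearD /= IHy !tassocE tmapE tassocE tmapE /= tmapE.
Qed.

End TensorFunctoriality.

Section Twisting.
Variable F : fieldType.

Lemma is_hom_bialgebra_id (H : lmodType F)
    (mu : {linear (H \ox H)%type -> H}) (Delta : {linear H -> (H \ox H)%type}) :
  is_bialgebra mu Delta -> is_hom_bialgebra mu Delta idfun.
Proof.
case=> mulA comulA compat; split=> //; split=> // x /=; by rewrite tmap_id.
Qed.

Lemma is_hom_coalgebra_twist (C : lmodType F)
    (Delta : {linear C -> (C \ox C)%type}) (alpha : {linear C -> C}) :
  is_coalgebra Delta -> is_coalgebra_endo Delta alpha ->
  is_hom_coalgebra (Delta \o alpha) alpha.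
Proof.
move=> coassoc endo; split=> x; first by rewrite /= -[RHS]endo.
(* By [endo], [Delta \o alpha] is [tmap alpha alpha \o Delta], so both sides become three copies of
   [alpha] applied after coassociativity at [alpha x]. *)
have tmapr : tmap alpha (Delta \o alpha)
    =1 tmap alpha (tmap alpha alpha) \o tmap idfun Delta.
  exact: tmap_comp.
have tmapl : tmap (Delta \o alpha) alpha
    =1 tmap (tmap alpha alpha) alpha \o tmap Delta idfun.
  exact: tmap_comp.
rewrite /= tmapr tmapl /= [RHS]tassoc_natural /=.
by congr (tmap _ _ _); exact: coassoc.
Qed.

Lemma is_hom_comodule_twist (H : lmodType F)
    (Delta : {linear H -> (H \ox H)%type}) (C : lmodType F)
    (delta : {linear C -> (H \ox C)%type}) (alpha : {linear C -> C}) :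
  tmap idfun delta \o delta =1 tassoc H H C \o tmap Delta idfun \o delta ->
  delta \o alpha =1 tmap idfun alpha \o delta ->
  is_hom_comodule Delta idfun alpha (delta \o alpha).
Proof.
move=> coact colin; split=> x; first by rewrite /= -[RHS]colin.
have tmapr : tmap (@idfun H) (delta \o alpha)
    =1 tmap idfun (tmap idfun alpha) \o tmap idfun delta.
  exact: tmap_comp.
(* The identity of [H \ox H] is inserted as [tmap idfun idfun] to give the shape required by
   [tassoc_natural]. *)
have tmapl : tmap Delta alpha
    =1 tmap (tmap idfun idfun) alpha \o tmap Delta idfun.
  by apply: tmap_comp => // h; rewrite /= tmap_id.
rewrite /= tmapr tmapl /= [RHS]tassoc_natural /=.
by congr (tmap _ _ _); exact: coact.
Qed.

(** Moving both copies of [alpha] to the input places them right after the comultiplication, where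
    the endomorphism property absorbs them. *)
Lemma codiagonal_comp (H C : lmodType F) (mu : {linear (H \ox H)%type -> H})
    (rho : {linear C -> (H \ox C)%type}) (alpha : {linear C -> C}) :
  codiagonal mu (rho \o alpha) =1 codiagonal mu rho \o tmap alpha alpha.
Proof.
move=> x; have factor : tmap (rho \o alpha) (rho \o alpha)
    =1 tmap rho rho \o tmap alpha alpha by exact: tmap_comp.
by rewrite /codiagonal /= factor.
Qed.

End Twisting.

Theorem corollary1p3 (F : fieldType) (H : lmodType F)
    (muH : {linear (H \ox H)%type -> H}) (DeltaH : {linear H -> (H \ox H)%type})
    (H_bialgebra : is_bialgebra muH DeltaH)
    (C : lmodType F) (DeltaC : {linear C -> (C \ox C)%type})
    (C_coalgebra : is_coalgebra DeltaC)
    (delta : {linear C -> (H \ox C)%type})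
    (C_comodule_coalgebra : is_comodule_coalgebra muH DeltaH DeltaC delta)
    (alphaC : {linear C -> C})
    (alphaC_coalgebra_endo : is_coalgebra_endo DeltaC alphaC)
    (alphaC_colinear : delta \o alphaC =1 tmap idfun alphaC \o delta) :
  is_comodule_hom_coalgebra muH DeltaH idfun
    (DeltaC \o alphaC) alphaC (delta \o alphaC).
Proof.
case: C_comodule_coalgebra => coact comul; split.
- exact: is_hom_bialgebra_id.
- exact: is_hom_coalgebra_twist.
- exact: is_hom_comodule_twist.
(* The right side is reduced to [tmap idfun DeltaC] of [delta] at [alphaC (alphaC x)]; colinearity
   then pulls one [alphaC] out of [delta]. *)
move=> x; rewrite [RHS]codiagonal_comp.
rewrite -[RHS]/(codiagonal muH delta (tmap alphaC alphaC ((DeltaC \o alphaC) x))).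
rewrite -[tmap _ _ _]alphaC_coalgebra_endo -[RHS]comul.
rewrite -[RHS]/(tmap idfun DeltaC ((delta \o alphaC) (alphaC x))).
rewrite alphaC_colinear.
(* The square of the twisting map of [H] is [idfun \o idfun], which splits alongside
   [DeltaC \o alphaC]. *)
exact: tmap_comp.
Qed.
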